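(* Let $\varphi:G\times X\to X$ be a continuous action of a finitely generated group $G$ on a compact metric space $(X,d)$. Then: (1) $\overline{\mathcal{M}_{PSh}(X,\varphi)}=\mathcal{M}(X)$ if and only if $\overline{PSh(\varphi)}=X$; (2) $\overline{\mathcal{M}_{Sh}(X,\varphi)}=\mathcal{M}(X)$ if and only if $\overline{Sh(\varphi)}=X$; (3) $\overline{\mathcal{M}_{\beta}(X,\varphi)}=\mathcal{M}(X)$ if and only if $\overline{Persis_\beta(\varphi)}=X$; (4) $\overline{\mathcal{M}_{\alpha}(X,\varphi)}=\mathcal{M}(X)$ if and only if $\overline{Persis_\alpha(\varphi)}=X$.
   Context: Fix a finite generating set $S$ of $G$ (discrete topology). For continuous actions $\varphi,\psi$ of $G$ on $X$ put $d_S(\varphi,\psi)=\sup\{d(\varphi(s,x),\psi(s,x)): x\in X, s\in S\}$. A map $f:G\to X$ is a $\delta$-pseudo orbit for $\psi$ if $d(f(sg),\psi(s,f(g)))<\delta$ for all $s\in S$, $g\in G$; it is $(\psi,\epsilon)$-shadowed by $p\in X$ if $d(f(g),\psi(g,p))<\epsilon$ for all $g\in G$. $Sh_\psi(\delta,\epsilon)$ is the set of $x\in X$ such that every $\delta$-pseudo orbit $f$ for $\psi$ with $f(e)=x$ is $(\psi,\epsilon)$-shadowed by a point of $X$. For continuous actions $\varphi,\psi$, $B(\epsilon,\varphi,\psi)$ is the set of $x\in X$ for which there is $y\in X$ with $d(\varphi(g,y),\psi(g,x))\le\epsilon$ for all $g\in G$. Sets of points. Below, ''for all $\psi$ $\delta$-close''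 means: for every continuous action $\psi:G\times X\to X$ with $d_S(\varphi,\psi)<\delta$. $Sh(\varphi)$: $x\in X$ such that for every $\epsilon>0$ there is $\delta>0$ with $x\in Sh_\varphi(\delta,\epsilon)$. $PSh(\varphi)$: $x\in X$ such that for every $\epsilon>0$ there is $\delta>0$ such that for all $\psi$ $\delta$-close every $\delta$-pseudo orbit $f$ for $\psi$ with $f(e)=x$ is $(\psi,\epsilon)$-shadowed by a point of $X$. $Persis_\alpha(\varphi)$ (resp. $Persis_\beta(\varphi)$): $x\in X$ such that for every $\epsilon>0$ there is $\delta>0$ such that for all $\psi$ $\delta$-close there is $y\in X$ with $d(\varphi(g,y),\psi(g,x))<\epsilon$ (resp. $d(\varphi(g,x),\psi(g,y))<\epsilon$) for all $g\in G$. Compatible measures. $\mathcal{M}(X)$ is the set of Borel probability measures on $X$ with the weak$^*$ topology, in which closures of sets of measures are taken. $\mu\in\mathcal{M}(X)$ belongs to $\mathcal{M}_{PSh}(X,\varphi)$ (resp. $\mathcal{M}_{Sh}(X,\varphi)$, $\mathcal{M}_\alpha(X,\varphi)$, $\mathcal{M}_\beta(X,\varphi)$) if for every $\epsilon>0$ there is $\delta>0$ such that for every Borel $A\subseteq X$ with $\mu(A)>0$: $A\cap Sh_\psi(\delta,\epsilon)\ne\emptyset$ for all $\psi$ $\delta$-close (resp. $A\cap Sh_\varphi(\delta,\epsilon)\neq\emptyset$; $A\cap B(\epsilon,\varphi,\psi)\neq\emptyset$ for all $\psi$ $\delta$-close; $A\cap B(\epsilon,\psi,\varphi)\neq\emptyset$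 for all $\psi$ $\delta$-close). *)

(* Defs.v *)
From HB Require Import structures.
From mathcomp Require Import all_boot all_order all_algebra.
From mathcomp Require Import all_classical all_reals all_analysis.
Set Implicit Arguments.
Unset Strict Implicit.
Unset Printing Implicit Defensive.
Import Order.TTheory GRing.Theory Num.Theory.
Import numFieldNormedType.Exports.
Local Open Scope classical_set_scope.
Local Open Scope ring_scope.

(* Measurable types of the library are pointed, so a space carrying Borel
   probability measures is taken to be nonempty. *)
#[short(type="pmetricType")]
HB.structure Definition PointedMetric (K : numDomainType) :=
  {M of Metric K M & Pointed M}.

Section FinitelyGenerated.
Variable G : groupType.

Definition is_subgroup (H : set G) : Prop :=
  [/\ H 1%g, forall g h, H g -> H h -> H (g * h)%g & forall g, H g -> H g^-1%g].

Definition generating (S : set G) : Prop := smallest is_subgroup S = [set: G].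

End FinitelyGenerated.

Record caction (G : groupType) (X : topologicalType) := CAction {
  act :> G -> X -> X;
  act1 : forall x, act 1%g x = x;
  actM : forall g h x, act (g * h)%g x = act g (act h x);
  act_continuous :
    continuous (fun p : discrete_topology G * X => act p.1 p.2)
}.

Section Dynamics.
Variables (R : realType) (X : metricType R) (G : groupType) (S : set G).
Implicit Types (phi psi : caction G X) (f : G -> X) (delta eps : R).

Definition dS phi psi : R :=
  sup [set mdist (phi s x) (psi s x) | s in S & x in [set: X]].

Definition pseudo_orbit psi delta f : Prop :=
  forall s g, S s -> mdist (f (s * g)%g) (psi s (f g)) < delta.

Definition shadowed psi eps f (p : X) : Prop :=
  forall g, mdist (f g) (psi g p) < eps.

Definition Shset psi delta eps : set X :=
  [set x | forall f, pseudo_orbit psi delta f -> f 1%g = x ->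
             exists p, shadowed psi eps f p].

Definition Bset eps phi psi : set X :=
  [set x | exists y, forall g, mdist (phi g y) (psi g x) <= eps].

Definition Sh phi : set X :=
  [set x | forall eps, 0 < eps -> exists2 delta, 0 < delta &
             Shset phi delta eps x].

Definition PSh phi : set X :=
  [set x | forall eps, 0 < eps -> exists2 delta, 0 < delta &
             forall psi, dS phi psi < delta ->
             forall f, pseudo_orbit psi delta f -> f 1%g = x ->
               exists p, shadowed psi eps f p].

Definition Persis_alpha phi : set X :=
  [set x | forall eps, 0 < eps -> exists2 delta, 0 < delta &
             forall psi, dS phi psi < delta ->
               exists y, forall g, mdist (phi g y) (psi g x) < eps].

Definition Persis_beta phi : set X :=
  [set x | forall eps, 0 < eps -> exists2 delta, 0 < delta &
             forall psi, dS phi psi < delta ->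
               exists y, forall g, mdist (phi g x) (psi g y) < eps].

End Dynamics.

Section BorelProbabilities.
Variables (R : realType) (X : pmetricType R).

Definition borel : measurableType _ := g_sigma_algebraType (@open X).

Definition integrals (mu : probability borel R) :
    {ptws continuousType X R -> R} :=
  fun f => (\int[mu]_x f x)%R.

(* The weak* topology is the coarsest one for which mu |-> \int f dmu is
   continuous for every continuous f : X -> R; on a compact X such an f is
   bounded, hence integrable. *)
Definition MX : topologicalType := initial_topology integrals.

End BorelProbabilities.

Section CompatibleMeasures.
Variables (R : realType) (X : pmetricType R) (G : groupType) (S : set G).
Variable phi : caction G X.

Definition M_PSh : set (MX X) :=
  [set mu : probability (borel X) R |
    forall eps : R, 0 < eps -> exists2 delta : R, 0 < delta &
    forall A : set (borel X), measurable A -> (0 < mu A)%E ->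
    forall psi : caction G X, dS S phi psi < delta ->
      A `&` Shset S psi delta eps !=set0].

Definition M_Sh : set (MX X) :=
  [set mu : probability (borel X) R |
    forall eps : R, 0 < eps -> exists2 delta : R, 0 < delta &
    forall A : set (borel X), measurable A -> (0 < mu A)%E ->
      A `&` Shset S phi delta eps !=set0].

Definition M_alpha : set (MX X) :=
  [set mu : probability (borel X) R |
    forall eps : R, 0 < eps -> exists2 delta : R, 0 < delta &
    forall A : set (borel X), measurable A -> (0 < mu A)%E ->
    forall psi : caction G X, dS S phi psi < delta ->
      A `&` Bset eps phi psi !=set0].

Definition M_beta : set (MX X) :=
  [set mu : probability (borel X) R |
    forall eps : R, 0 < eps -> exists2 delta : R, 0 < delta &
    forall A : set (borel X), measurable A -> (0 < mu A)%E ->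
    forall psi : caction G X, dS S phi psi < delta ->
      A `&` Bset eps psi phi !=set0].

End CompatibleMeasures.

(* Main.v *)
Require Import Defs.
From HB Require Import structures.
From mathcomp Require Import all_boot all_order all_algebra.
From mathcomp Require Import all_classical all_reals all_analysis.
From mathcomp Require Import measurable_realfun lra finmap.
Set Implicit Arguments.
Unset Strict Implicit.
Unset Printing Implicit Defensive.
Import Order.TTheory GRing.Theory Num.Theory.
Import numFieldNormedType.Exports metricType_numDomainType.
Local Open Scope classical_set_scope.
Local Open Scope ring_scope.

(** All four equivalences have the same shape. There is a family of sets
    [T psi delta eps] (points shadowing well, or traced by another action), a
    notion of [psi] being [delta]-close, and one compares the points lying in
    all the [T psi delta eps] (for each [eps], a suitable [delta] and every
    close [psi]) with the measures each of whose charged Borel sets meets all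
    of them. Lemma [dense_compatible_measures] proves the equivalence of the
    two densities from three facts: closeness and [T] are monotone in [delta],
    and the closure of [T psi delta (eps / 2)] is contained in
    [T psi (delta / 2) eps].

    From points to measures. A measure concentrated on finitely many compatible
    points is compatible: take the least of their [delta]s. Such measures are
    weak* dense when the points are dense in [X]: by compactness there are
    Borel maps [h n], taking finitely many values, all in the dense set, and
    moving points by less than [1 / (n + 1)]. The images of [mu] under [h n]
    converge to [mu] because, for [f] continuous, [f \o h n] tends to [f]
    pointwise and boundedly.

    From measures to points. Let [U] be open and nonempty. Near the Dirac mass
    at a point of [U] there is a compatible measure charging a compact ball
    contained in [U]; by compactness this ball contains a point [x] all of
    whose neighbourhoods are charged. The [delta] of a compatible measure
    depends neither on the charged set nor on [psi], so every neighbourhood of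
    [x] meets [T psi delta (eps / 2)], hence [x] belongs to its closure, and
    therefore to [T psi (delta / 2) eps]: the point [x] of [U] is compatible.

    The closure property holds for shadowable points because a pseudo orbit
    through [x] becomes one through a nearby [y] when its value at the identity
    is replaced by [y]: the generators being finitely many, this increases the
    error as little as desired (lemma [closure_Shset]). For persistent points it
    holds because the set of traced points is closed, being the projection of a
    closed set along a compact space (lemma [closed_Bset]). *)

(** * Metric and topological preliminaries *)

Section Metric.
Context {R : realType} {X : metricType R}.

Lemma nbhs_mdist_lt (x : X) (e : R) : 0 < e -> \forall y \near x, mdist x y < e.
Proof. by move=> e0; apply/nbhs_mdistP; exists e. Qed.

Lemma open_mdist_lt (c : X) (e : R) : open [set x | mdist c x < e].
Proof.
rewrite openE => x /= cx; apply/nbhs_mdistP; exists (e - mdist c x) => /=.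
  by rewrite subr_gt0.
move=> y /= xy; have := metric_triangle c x y; lra.
Qed.

Lemma continuous_mdist (c : X) : continuous (fun x => mdist c x : R).
Proof.
move=> x; apply/(@cvgrPdist_lt R R^o) => e e0.
near=> y; have xy : mdist x y < e by near: y; exact: nbhs_mdist_lt.
rewrite ltr_norml; have := metric_triangle c x y; have := metric_triangle c y x.
rewrite (metric_sym y x); lra.
Unshelve. all: by end_near. Qed.

Lemma closed_mdist_le (c : X) (e : R) : closed [set x | mdist c x <= e].
Proof.
rewrite (_ : mkset _ = (fun x => mdist c x) @^-1` [set t | t <= e])//.
by apply: closed_comp => [x _|]; [exact: continuous_mdist|exact: closed_le].
Qed.

(** Joint lower semicontinuity of the distance, in the neighbourhood form that
    compactness arguments consume. *)
Lemma mdist_lt_near2 (x y : X) (e : R) : e < mdist x y ->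
  \forall x' \near x & y' \near y, e < mdist x' y'.
Proof.
move=> exy; pose r := (mdist x y - e) / 2.
have r0 : 0 < r by rewrite /r; lra.
exists ([set x' | mdist x x' < r], [set y' | mdist y y' < r]) => /=.
  by split; exact: nbhs_mdist_lt.
move=> [x' y'] /= [xx' yy'].
have := metric_triangle x x' y; have := metric_triangle x' y' y.
rewrite (metric_sym y' y) /r in xx' yy' *; lra.
Qed.

End Metric.

Lemma caction_continuous (G : groupType) (X : topologicalType)
  (psi : caction G X) (g : G) : continuous (psi g).
Proof.
move=> x; pose gx : discrete_topology G * X := (g, x).
have pairx : (fun y => (g, y) : discrete_topology G * X) @ x --> gx.
  by apply: (@cvg_pair _ _ _ _ (nbhs (g : discrete_topology G)) (nbhs x)) => //;
     exact: cvg_cst.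
exact: cvg_comp pairx (@act_continuous G X psi gx).
Qed.

Lemma cvg_initial (I : Type) (F : set_system I) (S : choiceType)
    (T : topologicalType) (w : S -> T) (u : I -> S) (y : S) :
  Filter F -> w (u i) @[i --> F] --> w y ->
  u @ F --> (y : initial_topology w).
Proof.
move=> FF wu V [_ [[W oW <-]]] /= Wy /filterS; apply.
by apply: wu; exact: open_nbhs_nbhs.
Qed.

Lemma bounded_integrable d (T : measurableType d) (R : realType)
    (mu : probability T R) (f : T -> R) (M : R) :
  measurable_fun setT f -> (forall x, `|f x| <= M) ->
  mu.-integrable setT (EFin \o f).
Proof.
move=> mf fM; apply: measurable_bounded_integrable => //.
  exact: le_lt_trans (probability_le1 mu measurableT) (ltry 1).
exists M; split; first exact: num_real.
by move=> e Me x _; exact: le_trans (fM x) (ltW Me).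
Qed.

(** * Borel functions and integrals on a compact metric space *)

Section BorelIntegration.
Context {R : realType} {X : pmetricType R}.

Lemma open_borel (U : set X) : open U -> measurable (U : set (borel X)).
Proof. by move=> oU; exact: sub_sigma_algebra. Qed.

Lemma closed_borel (K : set X) : closed K -> measurable (K : set (borel X)).
Proof.
move=> cK; rewrite -[K]setCK; apply: measurableC; apply: open_borel.
exact: closed_openC.
Qed.

Lemma continuous_borel_measurable (f : X -> R) : continuous f ->
  measurable_fun [set: borel X] (f : borel X -> R).
Proof.
move=> /continuousP cf.
apply: (measurability _ (RGenOInfty.measurableE R)).
move=> _ [_ [a ->] <-]; rewrite setTI; apply: open_borel.
by apply: cf; exact: interval_open.
Qed.

Context (compactX : compact [set: X]).

Lemma continuous_bounded (f : X -> R) : continuous f ->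
  exists M : R, forall x, `|f x| <= M.
Proof.
move=> cf.
have /compact_bounded [M [_ fM]] : compact (f @` [set: X] : set R^o).
  by apply: continuous_compact => //; exact: continuous_subspaceT.
exists (M + 1) => x; apply: (fM (M + 1)); first by rewrite ltrDl.
by exists x.
Qed.

Lemma continuous_integrable (mu : probability (borel X) R) (f : X -> R) :
  continuous f -> mu.-integrable [set: borel X] (EFin \o f).
Proof.
move=> cf; have [M fM] := continuous_bounded cf.
exact: bounded_integrable (continuous_borel_measurable cf) fM.
Qed.

(** * Measures concentrated on finite sets are weak* dense *)

(** The map sends a point to the first entry of the list at distance less than
    [e]; it is Borel because each test is an open condition. *)
Lemma measurable_first_close (e : R) (s : seq X) :
  exists h : borel X -> borel X, measurable_fun setT h /\
   forall x, (exists2 c, c \in s & mdist c x < e) ->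
     h x \in s /\ mdist (h x) x < e.
Proof.
elim: s => [|c s [h [mh hP]]].
  by exists (cst point); split; [exact: measurable_cst | move=> x []].
exists (fun x => if mdist c x < e then c else h x); split.
  apply: (measurable_fun_ifT (f := fun x : borel X => mdist (c : X) x < e)
    _ _ mh); last exact: measurable_cst.
    apply: (measurable_fun_bool true); rewrite setTI.
    exact: (open_borel (open_mdist_lt c e)).
move=> x [b]; rewrite inE; case: ifPn => [cx _ _|ncx].
  by rewrite inE eqxx.
move=> /orP[/eqP ->|bs bx]; first by rewrite (negPf ncx).
by have [] := hP x (ex_intro2 _ _ b bs bx); rewrite inE => -> ->; rewrite orbT.
Qed.

Lemma finite_valued_approximation (D : set X) (e : R) :
  closure D = setT -> 0 < e ->
  exists h : borel X -> borel X, exists F : set X,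
  [/\ measurable_fun setT h, finite_set F, F `<=` D,
      forall x, F (h x) & forall x, mdist (h x) x < e].
Proof.
move=> dD e0; move: (compactX); rewrite compact_cover.
move=> /(_ X D (fun c => [set x | mdist c x < e])).
case.
- by move=> c _; exact: open_mdist_lt.
- move=> x _.
  have [y [Dy xy]] : D `&` [set y | mdist x y < e] !=set0.
    have : closure D x by rewrite dD.
    by apply; exact: nbhs_mdist_lt.
  by exists y => //=; rewrite metric_sym.
move=> F FD Fcov; have [h [mh hP]] :=
  measurable_first_close e (enum_fset F).
have {}hP x : h x \in enum_fset F /\ mdist (h x) x < e.
  by apply: hP; have [c cF cx] := Fcov x I; exists c.
exists h, [set` F]; split => //.
- by move=> x /FD /set_mem.
- by move=> x; have [] := hP x.
- by move=> x; have [] := hP x.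
Qed.

Definition charges_finite_subset (D : set X) : set (MX X) :=
  [set mu : probability (borel X) R | exists F : set X,
    [/\ finite_set F, F `<=` D &
     forall A : set (borel X), measurable A -> (0 < mu A)%E -> A `&` F !=set0]].

Lemma MX_cvg (u : nat -> MX X) (mu : MX X) :
  (forall f : continuousType X R,
     integrals (u n) f @[n --> \oo] --> (integrals mu f : R)) ->
  u @ \oo --> mu.
Proof.
move=> cu; apply: cvg_initial; apply/cvg_sup => f.
by apply: cvg_initial; exact: cu.
Qed.

(** The approximants of [mu] are its images under finite-valued maps tending to
    the identity, so that the convergence of integrals is an instance of
    dominated convergence. *)
Lemma dense_charges_finite_subset (D : set X) : closure D = setT ->
  closure (charges_finite_subset D) = setT.
Proof.
move=> dD; apply/seteqP; split => // mu _.
have e0 (n : nat) : (0 : R) < n.+1%:R^-1 by rewrite invr_gt0.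
have /choice [h] := fun n : nat => finite_valued_approximation dD (e0 n).
move=> /choice [F hF].
pose hM n := MeasurableFun.Pack (MeasurableFun.Class
  (isMeasurableFun.Build _ _ _ _ (h n) (let: And5 m _ _ _ _ := hF n in m))).
pose nu n : probability (borel X) R :=
  distribution (mu : probability (borel X) R) (hM n).
have nuD n : charges_finite_subset D (nu n).
  have [_ fF FD Fh _] := hF n; exists (F n); split => // A mA nuA.
  apply: contrapT => AF0; have hA0 : h n @^-1` A = set0.
    by apply/seteqP; split => // x /= Ax; apply: AF0; exists (h n x).
  have nuA0 : nu n A = 0%E.
    by rewrite -(measure0 (nu n)) -[LHS]/(_ (h n @^-1` A)) hA0.
  by move: nuA; rewrite nuA0 ltxx.
have hcvg x : h n x @[n --> \oo] --> (x : X).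
  apply/cvgrPdist_lt => e e_gt0; near=> n.
  have [_ _ _ _ hx] := hF n; rewrite metric_sym (lt_trans (hx x))//.
  by near: n; exact: (near_infty_natSinv_lt (PosNum e_gt0)).
move=> V /(@MX_cvg nu mu) H.
suff : \forall n \near \oo, V (nu n).
  by move=> [n _ Vn]; exists (nu n); split => //; exact: (Vn n (leqnn _)).
apply: H => f; rewrite /integrals /Rintegral.
have cf : continuous f by exact: cts_fun.
have mf := continuous_borel_measurable cf.
have [M fM] := continuous_bounded cf.
apply: fine_cvg; rewrite fineK; last first.
  exact/integrable_fin_num/continuous_integrable.
have nuE n : (\int[nu n]_x (f x)%:E =
    \int[(mu : probability (borel X) R)]_x (f (h n x))%:E)%E.
  rewrite integral_pushforward//.
    exact/measurable_EFinP.
  apply: (@bounded_integrable _ _ _ _ (f \o h n) M) => //.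
    by apply: measurableT_comp => //; have [] := hF n.
  by move=> x; exact: fM.
rewrite (eq_cvg _ _ nuE).
apply: (@dominated_cvg _ _ _ _ _ _ _ _ (fun=> M%:E)) => //.
- move=> n; apply/measurable_EFinP; apply: measurableT_comp => //.
  by have [] := hF n.
- move=> x _; apply: cvg_EFin; first by near=> n.
  exact: (@cvg_comp _ _ _ (fun n => h n x) f _ _ _ (hcvg x) (cf x)).
- exact: (@bounded_integrable _ _ _ _ (fun=> M) `|M|).
- by move=> n x _; rewrite lee_fin.
Unshelve. all: by end_near. Qed.

(** * Charged neighbourhoods *)

Lemma integral_continuous (f : continuousType X R) :
  continuous (fun mu : MX X => integrals mu f : R).
Proof.
move=> mu; apply: (@cvg_comp _ _ _ (fun nu : MX X => integrals nu)
  (fun w : {ptws continuousType X R -> R} => w f) _ (nbhs (integrals mu))).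
  exact: initial_continuous.
exact: (@proj_continuous _ (fun _ : continuousType X R => R) f (integrals mu)).
Qed.

(** A continuous function that is positive at [u] and vanishes off the closed
    ball of radius [r], to test measures against. *)
Definition tent (u : X) (r : R) (x : X) : R := Num.max 0 (r - mdist u x).

Lemma tent_continuous u r : continuous (tent u r).
Proof.
move=> x; apply: (@continuous_max R X (fun=> 0) (fun x => r - mdist u x)).
  exact: cvg_cst.
by apply: cvgB; [exact: cvg_cst | exact: continuous_mdist].
Qed.

HB.instance Definition _ u r :=
  isContinuous.Build X R (tent u r) (@tent_continuous u r).

(** The condition that the integral of [tent u r] be positive is weak* open and
    holds for the Dirac mass at [u]; a measure satisfying it charges the ball
    off which [tent u r] vanishes. *)
Lemma dense_measures_charge_ball (N : set (MX X)) (u : X) (r : R) :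
  closure N = setT -> 0 < r -> exists2 mu : probability (borel X) R,
    N mu & mu ([set x | mdist u x <= r] : set (borel X)) != 0%E.
Proof.
move=> dN r0.
pose K : set (borel X) := [set x | mdist u x <= r].
have mK : measurable K := closed_borel (@closed_mdist_le _ _ u r).
have tent0 x : ~ mdist u x <= r -> tent u r x = 0.
  by move=> /negP; rewrite -ltNge /tent => h; apply/max_idPl; lra.
have mtent : measurable_fun [set: borel X] (fun x : borel X => (tent u r x)%:E).
  apply/measurable_EFinP.
  exact: continuous_borel_measurable (@tent_continuous u r).
pose f : continuousType X R := tent u r.
have fu : nbhs (integrals (\d_(u : borel X)) f : R) [set t | 0 < t].
  apply: (@open_nbhs_nbhs R); split; first exact: open_gt.
  rewrite /= /integrals /Rintegral integral_dirac//.
  by rewrite diracT mul1e /= /tent mdistxx subr0 lt_max r0 orbT.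
have {fu} := integral_continuous fu.
have : closure N (\d_(u : borel X)) by rewrite dN.
move=> /[apply] -[mu [Nmu fmu]]; exists mu => //.
apply/eqP => muK0; move: fmu; rewrite /= /integrals /Rintegral.
suff -> : (\int[(mu : probability (borel X) R)]_x (f x)%:E = 0)%E.
  by rewrite ltxx.
rewrite -[RHS](null_set_integral mK (measurable_funTS mtent) muK0).
rewrite [RHS]integral_mkcond; apply: eq_integral => x _.
by rewrite /patch; case: ifPn => //; rewrite notin_setE => /= /tent0 ->.
Qed.

(** Otherwise [K] would be covered by finitely many null open sets. *)
Lemma compact_support_point (mu : probability (borel X) R) (K : set X) :
  compact K -> mu (K : set (borel X)) != 0%E ->
  measurable (K : set (borel X)) ->
  exists2 x, K x & forall V : set X, open V -> V x ->
    (0 < mu (V : set (borel X)))%E.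
Proof.
move=> cK muK mK; apply: contrapT => noK.
have nullV x : exists V : set X, K x ->
    [/\ open V, V x & mu (V : set (borel X)) = 0%E].
  have [Kx|] := pselect (K x); last by exists set0.
  apply: contrapT => h; apply: noK; exists x => // V oV Vx.
  rewrite measure_gt0; apply/eqP => V0; apply: h; exists V => _; split => //.
have /choice [V VP] := nullV.
move: cK; rewrite compact_cover => /(_ X K V); case.
- by move=> x /VP [].
- by move=> x Kx; exists x => //; have [] := VP x Kx.
move=> F FK KF; move/eqP: muK; apply.
apply/eqP; rewrite eq_le measure_ge0 andbT.
have -> : 0%E = (\sum_(x \in [set` F]) mu (V x : set (borel X)))%E.
  by rewrite fsbig1// => x /FK/set_mem/VP [].
apply: content_sub_fsum => // x /FK/set_mem/VP [oV _ _].
exact: open_borel.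
Qed.

Lemma charge_all_neighborhoods (N : set (MX X)) (U : set X) (u : X) :
  closure N = setT -> open U -> U u -> exists mu : probability (borel X) R,
    N mu /\ exists2 x, U x & forall V : set X, open V -> V x ->
      (0 < mu (V : set (borel X)))%E.
Proof.
move=> dN oU Uu.
have /nbhs_mdistP [e /= e0 eU] : nbhs u U by exact: open_nbhs_nbhs.
have e20 : 0 < e / 2 by rewrite divr_gt0.
have [mu Nmu muK] := dense_measures_charge_ball u dN e20.
have cK : compact [set x | mdist u x <= e / 2].
  exact: subclosed_compact (@closed_mdist_le _ _ _ _) compactX _.
have mK := closed_borel (@closed_mdist_le _ _ u (e / 2)).
have [x Kx xV] := compact_support_point cK muK mK.
by exists mu; split => //; exists x => //; apply: eU => /=; move: Kx => /=; lra.
Qed.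

(** * Dense points and dense measures, abstractly *)

Section Compatible.
Context {I : Type} (close : R -> I -> Prop) (T : I -> R -> R -> set X).

(** The index [i] ranges over the perturbed actions, [close d i] says that the
    action [i] is [d]-close to the given one, and [T i d e] is the set of its
    good points. *)
Definition compatible_points : set X :=
  [set x | forall eps, 0 < eps -> exists2 delta, 0 < delta &
    forall i, close delta i -> T i delta eps x].

Definition compatible_measures : set (MX X) :=
  [set mu : probability (borel X) R |
    forall eps : R, 0 < eps -> exists2 delta : R, 0 < delta &
    forall A : set (borel X), measurable A -> (0 < mu A)%E ->
    forall i, close delta i -> A `&` T i delta eps !=set0].

Hypothesis close_le : forall d d' i, d' <= d -> close d' i -> close d i.
Hypothesis T_le : forall i e d d', d' <= d -> T i d e `<=` T i d' e.
Hypothesis T_closure : forall i d e, 0 < d -> 0 < e ->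
  closure (T i d (e / 2)) `<=` T i (d / 2) e.

Lemma charges_finite_subset_compatible :
  charges_finite_subset compatible_points `<=` compatible_measures.
Proof.
move=> mu [F [/finite_seqP [s ->] FD muF]] eps e0.
have [d d0 sd] : exists2 d, 0 < d &
    forall x, x \in s -> forall i, close d i -> T i d eps x.
  have {muF}FD x : x \in s -> compatible_points x by exact: FD.
  elim: s FD => [|x s IH] FD; first by exists 1.
  have [|d1 d10 sd1] := IH.
    by move=> y ys; apply: FD; rewrite inE ys orbT.
  have [|d2 d20 sd2] := FD x _ eps e0; first by rewrite inE eqxx.
  exists (Num.min d1 d2); first by rewrite lt_min d10.
  have le1 : Num.min d1 d2 <= d1 by rewrite ge_min lexx.
  have le2 : Num.min d1 d2 <= d2 by rewrite ge_min lexx orbT.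
  move=> y; rewrite inE => /orP[/eqP ->|ys] i di.
    by apply: (T_le le2); apply: sd2; exact: close_le le2 di.
  by apply: (T_le le1); apply: sd1 => //; exact: close_le le1 di.
exists d => // A mA A0 i di; have [x [Ax sx]] := muF A mA A0.
by exists x; split => //; exact: sd.
Qed.

(** Here the uniformity matters that distinguishes a compatible measure: its
    [d] does not depend on the charged set, so it serves for all neighbourhoods
    of [x] at once. *)
Lemma compatible_measure_support (mu : probability (borel X) R) (x : X) :
  compatible_measures mu ->
  (forall V : set X, open V -> V x -> (0 < mu (V : set (borel X)))%E) ->
  compatible_points x.
Proof.
move=> muC xV e e0; have e20 : 0 < e / 2 by rewrite divr_gt0.
have [d d0 dA] := muC _ e20.
exists (d / 2); first by rewrite divr_gt0.
move=> i di; apply: T_closure => // U; rewrite nbhsE => -[V [oV Vx] VU].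
have [|y [Vy Ty]] := dA V (open_borel oV) (xV V oV Vx) i.
  by apply: close_le di; lra.
by exists y; split => //; exact: VU.
Qed.

Lemma dense_compatible_measures :
  closure compatible_measures = setT <-> closure compatible_points = setT.
Proof.
split=> [dM|dP]; apply/seteqP; split => //.
  move=> x _ V; rewrite nbhsE => -[U [oU Ux] UV].
  have [mu [Mmu [y Uy yV]]] := charge_all_neighborhoods dM oU Ux.
  exists y; split; last exact: UV.
  exact: compatible_measure_support Mmu yV.
rewrite -(dense_charges_finite_subset dP); apply: closureS.
exact: charges_finite_subset_compatible.
Qed.

End Compatible.
End BorelIntegration.

(** Families that interleave up to halving [e] have the same compatible points;
    this reconciles strict and large inequalities. *)
Lemma eq_compatible_points (R : realType) (X : pmetricType R) (I : Type)
    (close : R -> I -> Prop) (T T' : I -> R -> R -> set X) :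
  (forall i d e, 0 < e -> T i d e `<=` T' i d e) ->
  (forall i d e, 0 < e -> T' i d (e / 2) `<=` T i d e) ->
  compatible_points close T = compatible_points close T'.
Proof.
move=> TT' T'T; apply/seteqP; split => x xT e e0.
  have [d d0 dT] := xT e e0; exists d => // i di.
  by apply: TT' => //; exact: dT.
have e20 : 0 < e / 2 by rewrite divr_gt0.
have [d d0 dT] := xT _ e20; exists d => // i di.
by apply: T'T => //; exact: dT.
Qed.

(** * Stability of shadowable and of traced points under closure *)

Section Actions.
Context {R : realType} {X : metricType R} {G : groupType}.
Implicit Types (phi psi : caction G X) (S : set G).

Lemma Shset_le S psi d d' e : d' <= d -> Shset S psi d e `<=` Shset S psi d' e.
Proof.
move=> dd x xS f fpo fx; apply: xS => // s g Ss.
exact: lt_le_trans (fpo s g Ss) dd.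
Qed.

Lemma finite_near_act S psi (x : X) (e : R) : finite_set S -> 0 < e ->
  \forall y \near x, forall s, S s -> mdist (psi s x) (psi s y) < e.
Proof.
move=> /finite_seqP [l ->] e0.
suff : \forall y \near x, forall s, s \in l ->
    mdist (psi s x) (psi s y) < e by [].
elim: l => [|t l IH]; first by near=> y.
have psit : \forall y \near x, mdist (psi t x) (psi t y) < e.
  exact: cvgr_dist_lt (@caction_continuous _ _ psi t x) _ e0.
near=> y => s; rewrite inE => /orP[/eqP ->|]; first by near: y.
by move: s; near: y.
Unshelve. all: by end_near. Qed.

(** Given a pseudo orbit [f] with [f 1 = x], choose [y] in the set close to [x]
    and replace the value of [f] at [1] by [y]. The error conditions that change
    are those at [g = 1], controlled by the continuity of the finitely many maps
    [psi s], and those with [s * g = 1], controlled by the distance from [x] to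
    [y]. *)
Lemma closure_Shset S psi d e : finite_set S -> 0 < d -> 0 < e ->
  closure (Shset S psi d (e / 2)) `<=` Shset S psi (d / 2) e.
Proof.
move=> finS d0 e0 x xcl f fpo fx.
have d20 : 0 < d / 2 by rewrite divr_gt0.
have e20 : 0 < e / 2 by rewrite divr_gt0.
have [y [yS [[xyd xye] xys]]] : Shset S psi d (e / 2) `&`
    [set y | (mdist x y < d / 2 /\ mdist x y < e / 2) /\
      forall s, S s -> mdist (psi s x) (psi s y) < d / 2] !=set0.
  apply: xcl; near=> y; split; first split.
  - by near: y; exact: nbhs_mdist_lt.
  - by near: y; exact: nbhs_mdist_lt.
  - by near: y; exact: finite_near_act.
pose f' g := if g == 1%g then y else f g.
have [||p pf'] := yS f'.
- move=> s g Ss; rewrite /f'; have := fpo s g Ss.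
  case: (eqVneq g 1%g) => [->|g1]; rewrite ?mulg1.
    case: (eqVneq s 1%g) => [->|s1]; first by rewrite !act1 !mdistxx.
    rewrite fx; have := xys s Ss.
    have := metric_triangle (f s) (psi s x) (psi s y); lra.
  case: (eqVneq (s * g)%g 1%g) => [->|sg1]; last by lra.
  rewrite fx; have := metric_triangle y x (psi s (f g)).
  by rewrite (metric_sym y x); lra.
- by rewrite /f' eqxx.
exists p => g; have := pf' g; rewrite /f'.
case: (eqVneq g 1%g) => [->|g1]; last by lra.
by rewrite fx; have := metric_triangle x y (psi 1%g p); lra.
Unshelve. all: by end_near. Qed.

Lemma Bset_le e e' phi psi : e <= e' -> Bset e phi psi `<=` Bset e' phi psi.
Proof. by move=> ee x [y xy]; exists y => g; exact: le_trans (xy g) ee. Qed.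

(** If no [y] traces the [psi]-orbit of [x], each [y] fails at some [g], and
    still fails when [y] and [x] are moved a little; by compactness of the
    space of the [y] a single neighbourhood of [x] works for all of them. *)
Lemma closed_Bset e phi psi : compact [set: X] -> closed (Bset e phi psi).
Proof.
move=> /compact_near_coveringP cX x xcl; apply: contrapT => xB.
have : \forall x' \near x, [set: X] `<=`
    [set y | exists g, e < mdist (phi g y) (psi g x')].
  apply: cX => y _.
  have [g gxy] : exists g, e < mdist (phi g y) (psi g x).
    apply: contrapT => h; apply: xB; exists y => g; rewrite leNgt.
    by apply/negP => ?; apply: h; exists g.
  have [[A B] /= [Ay Bx] AB] := mdist_lt_near2 gxy.
  exists (phi g @^-1` A, psi g @^-1` B) => /=.
    by split; [exact: caction_continuous Ay|exact: caction_continuous Bx].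
  by move=> [y' x'] /= [Ay' Bx']; exists g; exact: (AB (_, _)).
by move=> /xcl [x' [[y xy] /(_ y I) [g]]]; rewrite ltNge xy.
Qed.

Lemma closure_Bset e phi psi : compact [set: X] -> 0 < e ->
  closure (Bset (e / 2) phi psi) `<=` Bset e phi psi.
Proof.
move=> cX e0; rewrite -(closure_id _).1; last exact: closed_Bset.
apply: Bset_le; lra.
Qed.

End Actions.

Theorem proposition3p16 (R : realType) (X : pmetricType R) (G : groupType)
    (S : set G) (finS : finite_set S) (genS : generating S)
    (compactX : compact [set: X]) (phi : caction G X) :
  [/\ closure (M_PSh S phi) = [set: MX X] <-> closure (PSh S phi) = [set: X],
      closure (M_Sh S phi) = [set: MX X] <-> closure (Sh S phi) = [set: X],
      closure (M_beta S phi) = [set: MX X] <->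
        closure (Persis_beta S phi) = [set: X] &
      closure (M_alpha S phi) = [set: MX X] <->
        closure (Persis_alpha S phi) = [set: X]].
Proof.
pose close (d : R) (psi : caction G X) := dS S phi psi < d.
have close_le d d' psi : d' <= d -> close d' psi -> close d psi.
  by move=> dd psid; exact: lt_le_trans psid dd.
split.
- apply: (@dense_compatible_measures _ _ compactX _ close (Shset S)) => //.
  + by move=> psi e d d'; exact: Shset_le.
  + by move=> psi d e d0 e0; exact: closure_Shset.
(* Only [phi] itself is involved here, so there is a single index. *)
- have -> : M_Sh S phi = compatible_measures (fun _ (_ : unit) => True)
      (fun=> Shset S phi).
    apply/seteqP; split => mu muS e /muS [d d0 dS]; exists d => // A mA A0.
      by move=> _ _; exact: dS.
    exact: (dS A mA A0 tt I).
  have -> : Sh S phi = compatible_points (fun _ (_ : unit) => True)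
      (fun=> Shset S phi).
    apply/seteqP; split => x xS e /xS [d d0 dS]; exists d => //.
    exact: (dS tt I).
  apply: (dense_compatible_measures compactX) => //.
  + by move=> _ e d d'; exact: Shset_le.
  + by move=> _ d e d0 e0; exact: closure_Shset.
- have -> : Persis_beta S phi =
      compatible_points close (fun psi _ e => Bset e psi phi).
    apply: (@eq_compatible_points _ _ _ close (fun psi _ e =>
      [set x | exists y, forall g, mdist (phi g x) (psi g y) < e])).
      move=> psi _ e e0 x [y xy]; exists y => g.
      by rewrite metric_sym; exact/ltW.
    move=> psi _ e e0 x [y xy]; exists y => g.
    by rewrite metric_sym (le_lt_trans (xy g))//; lra.
  apply: (dense_compatible_measures compactX) => //.
  + by move=> psi e d d' _ x.
  + by move=> psi d e d0 e0; exact: closure_Bset.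
- have -> : Persis_alpha S phi =
      compatible_points close (fun psi _ e => Bset e phi psi).
    apply: (@eq_compatible_points _ _ _ close (fun psi _ e =>
      [set x | exists y, forall g, mdist (phi g y) (psi g x) < e])).
      by move=> psi _ e e0 x [y xy]; exists y => g; exact/ltW.
    move=> psi _ e e0 x [y xy]; exists y => g.
    by rewrite (le_lt_trans (xy g))//; lra.
  apply: (dense_compatible_measures compactX) => //.
  + by move=> psi e d d' _ x.
  + by move=> psi d e d0 e0; exact: closure_Bset.
Qed.
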